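(* Let $\beta_1,\beta_2,\gamma_1,\gamma_2\in\mathbb{C}$ and assume that $\beta_1\neq\beta_2$. Then the initial equation possesses a unique formal fundamental matrix $\hat\Phi_0(x,0)$ at the origin in the form $$\hat\Phi_0(x,0)=\exp(Gx)\,\hat H(x)\,x^{\Lambda}\exp\left(-\frac Bx\right),\quad G=\mathrm{diag}(\gamma_1,\gamma_2),\ \Lambda=\mathrm{diag}(0,-2),\ B=\mathrm{diag}(\beta_1,\beta_2).$$ The matrix $\hat H(x)$ is given by $$\hat H(x)=\begin{pmatrix}1&\frac{x^2e^{(\gamma_2-\gamma_1)x}}{\beta_2-\beta_1}-\frac{(\gamma_2-\gamma_1)x^3\hat\psi(x)}{\beta_2-\beta_1}\\0&1\end{pmatrix}.$$ The element $\hat\psi(x)$ is represented by the formal power series $$\hat\psi(x)=\sum_{k=1}^\infty\frac{(-1)^k\,k!\,S_{k-1}}{(\beta_2-\beta_1)^k}\,x^k,$$ where $S_{k-1}=\sum_{n=0}^{k-1}\frac{(-1)^{n+1}(\gamma_2-\gamma_1)^n(\beta_2-\beta_1)^n}{n!\,(n+1)!}$, $k\in\mathbb{N}$, are the partial sums of the absolutely convergent number series $$S=\sum_{n=0}^\infty\frac{(-1)^{n+1}(\gamma_2-\gamma_1)^n(\beta_2-\beta_1)^n}{n!\,(n+1)!}.$$ Moreover: (1) if $S\neq0$ but $\gamma_1\neq\gamma_2$, then the formal power series $\hat\psi(x)$ is divergent; (2) if $S=0$ but $\gamma_1\neq\gamma_2$, then the power series $\hat\psi(x)$ represents a function analytic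 in $\mathbb{C}$; (3) if $\gamma_1=\gamma_2$, then $\hat\psi(x)=\frac{x}{\beta_2-\beta_1}$, but the matrix $\hat H(x)$ has the form $\hat H(x)=\begin{pmatrix}1&\frac{x^2}{\beta_2-\beta_1}\\0&1\end{pmatrix}$.
   Context: Initial equation: $L_2(L_1 y)=0$ with $L_1=\partial-\left(\frac{\beta_1}{x^2}+\gamma_1\right)$, $L_2=\partial-\left(-\frac{2}{x}+\frac{\beta_2}{x^2}+\gamma_2\right)$, $\partial=\frac{d}{dx}$. Its fundamental matrices are taken of the form $\begin{pmatrix}\Phi_1&\Phi_{12}\\0&\Phi_2\end{pmatrix}$, where $\Phi_1=e^{\gamma_1x}e^{-\beta_1/x}$ solves $L_1u=0$, $\Phi_2=x^{-2}e^{\gamma_2x}e^{-\beta_2/x}$ solves $L_2u=0$, and $\Phi_{12}(x)=\Phi_1(x)\int_{\Gamma}\frac{\Phi_2(z)}{\Phi_1(z)}\,dz$ (so $L_1\Phi_{12}=\Phi_2$); for the matrix at the origin, $\Gamma$ is a path from $0$ to $x$ approaching $0$ in the direction $\arg(\beta_2-\beta_1)$. The formal fundamental matrix at the origin is obtained by expressing this integral through formal power series in $x$: the entries of $\hat H(x)$ are formal power series in $x$, and $x^{\Lambda}$, $\exp(Gx)$, $\exp(-B/x)$ are regarded as formal functions.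
   Formalization: In (3) the claim ψ̂ = x/(β2−β1) is false (for γ1=γ2 the x² coefficient of ψ̂ is −2/(β2−β1)² ≠ 0); it is replaced by: x/(β2−β1) is the leading term of ψ̂, and putting it in place of ψ̂ leaves Ĥ unchanged. *)

(* Defs.v *)
From HB Require Import structures.
From mathcomp Require Import all_boot all_order all_algebra.
From mathcomp Require Import all_classical all_reals all_analysis.
From mathcomp Require Import complex ring zify.

Set Implicit Arguments.
Unset Strict Implicit.
Unset Printing Implicit Defensive.

Import Order.TTheory GRing.Theory Num.Theory numFieldNormedType.Exports.
Local Open Scope classical_set_scope.
Local Open Scope ring_scope.

(** ** Formal power series K[[x]] *)

Record fps (K : fieldType) := Fps { coeffs :> nat -> K }.

HB.instance Definition _ (K : fieldType) := [isNew for @coeffs K].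
HB.instance Definition _ (K : fieldType) := [Choice of fps K by <:].

Section FpsRing.
Variable K : fieldType.
Implicit Types f g h : fps K.

Lemma fpsP f g : (forall n, f n = g n) -> f = g.
Proof. by case: f g => [f] [g] /= fg; congr Fps; apply/funext. Qed.

Definition fps_add f g := Fps (fun n => f n + g n).
Definition fps_opp f := Fps (fun n => - f n).

Fact fps_addA : associative fps_add.
Proof. by move=> f g h; apply: fpsP => n; exact: addrA. Qed.
Fact fps_addC : commutative fps_add.
Proof. by move=> f g; apply: fpsP => n; exact: addrC. Qed.
Fact fps_add0 : left_id (Fps (fun=> 0)) fps_add.
Proof. by move=> f; apply: fpsP => n; exact: add0r. Qed.
Fact fps_addN : left_inverse (Fps (fun=> 0)) fps_opp fps_add.
Proof. by move=> f; apply: fpsP => n; exact: addNr. Qed.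

HB.instance Definition _ :=
  GRing.isZmodule.Build (fps K) fps_addA fps_addC fps_add0 fps_addN.

Definition fps_const (c : K) := Fps (fun n => if n is 0%N then c else 0).
Definition fps_mul f g := Fps (fun n => \sum_(i < n.+1) f i * g (n - i)%N).

Let trunc n f : {poly K} := \poly_(i < n.+1) f i.

Let truncE n f i : (i <= n)%N -> (trunc n f)`_i = f i.
Proof. by move=> le_in; rewrite coef_poly ltnS le_in. Qed.

Let fps_mul_trunc n f g i : (i <= n)%N ->
  fps_mul f g i = (trunc n f * trunc n g)`_i.
Proof.
move=> le_in; rewrite coefM; apply: eq_bigr => j _.
have le_jn : (j <= n)%N by rewrite (leq_trans _ le_in) -1?ltnS.
by rewrite !truncE // (leq_trans (leq_subr _ _)).
Qed.

Fact fps_mulC : commutative fps_mul.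
Proof.
by move=> f g; apply: fpsP => n; rewrite !(@fps_mul_trunc n) // mulrC.
Qed.

Fact fps_mulA : associative fps_mul.
Proof.
move=> f g h; apply: fpsP => n.
have mulE f1 f2 (p : {poly K}) : (forall i, (i <= n)%N -> f2 i = p`_i) ->
    fps_mul f1 f2 n = (trunc n f1 * p)`_n.
  move=> f2E; rewrite coefM; apply: eq_bigr => i _.
  by rewrite truncE -1?ltnS // f2E // leq_subr.
rewrite (mulE f _ (trunc n g * trunc n h)); last first.
  by move=> i; exact: fps_mul_trunc.
rewrite fps_mulC (mulE h _ (trunc n f * trunc n g)); last first.
  by move=> i; exact: fps_mul_trunc.
by rewrite mulrA [in RHS]mulrC.
Qed.

Fact fps_mul1 : left_id (fps_const 1) fps_mul.
Proof.
move=> f; apply: fpsP => n; rewrite /= big_ord_recl subn0 mul1r big1 ?addr0 //.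
by move=> i _; rewrite mul0r.
Qed.

Fact fps_mulDl : left_distributive fps_mul fps_add.
Proof.
move=> f g h; apply: fpsP => n /=; rewrite -big_split.
by apply: eq_bigr => i _; rewrite mulrDl.
Qed.

Fact fps_1neq0 : fps_const 1 != 0 :> fps K.
Proof.
by apply/eqP => /(congr1 (fun f : fps K => f 0%N)) /eqP; rewrite oner_eq0.
Qed.

HB.instance Definition _ := GRing.Zmodule_isComNzRing.Build (fps K)
  fps_mulA fps_mulC fps_mul1 fps_mulDl fps_1neq0.

Lemma fps_coefD f g n : (f + g) n = f n + g n. Proof. by []. Qed.
Lemma fps_coefN f n : (- f) n = - f n. Proof. by []. Qed.
Lemma fps_coefM f g n : (f * g) n = \sum_(i < n.+1) f i * g (n - i)%N.
Proof. by []. Qed.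

Definition fps_X : fps K := Fps (fun n => (n == 1%N)%:R).
Definition fps_deriv f := Fps (fun n => f n.+1 *+ n.+1).

(** The formal power series of [e^(c x)]. *)
Definition fps_exp (c : K) := Fps (fun n => c ^+ n / n`!%:R).

Lemma fps_derivD f g : fps_deriv (f + g) = fps_deriv f + fps_deriv g.
Proof. by apply: fpsP => n; exact: mulrnDl. Qed.

Lemma fps_derivM f g :
  fps_deriv (f * g) = fps_deriv f * g + f * fps_deriv g.
Proof.
apply: fpsP => n; rewrite fps_coefD.
have -> : fps_deriv (f * g) n = (trunc n.+1 f * trunc n.+1 g)^`()`_n.
  by rewrite coef_deriv -fps_mul_trunc.
rewrite derivM coefD !coefM; congr (_ + _); apply: eq_bigr => i _.
  rewrite coef_deriv truncE ?ltnS -1?ltnS // truncE //.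
  by rewrite (leq_trans (leq_subr _ _)).
rewrite coef_deriv truncE; last by rewrite ltnW.
by rewrite truncE // ltnS leq_subr.
Qed.

End FpsRing.


(** ** Formal functions

    An element [f] stands for the sum over [(b, n)] of
    [f (b, n) * x^n * exp (- b / x)], where finitely many exponents [b] occur
    and the powers [n] of [x] are bounded below. *)

Section FormalFunctions.
Variable K : fieldType.
Implicit Types (c u v : K * int).

Definition formal_supp (f : K * int -> K) := `[< exists (B : set K) (N : int),
  finite_set B /\ forall c, f c != 0 -> B c.1 /\ N <= c.2 >].

Record formal := Formal {
  formal_coeff :> K * int -> K; _ : formal_supp formal_coeff }.

HB.instance Definition _ := [isSub for formal_coeff].
HB.instance Definition _ := [Choice of formal by <:].

Implicit Types f g h : formal.

Lemma formalP f g : (forall c, f c = g c) -> f = g.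
Proof. by move=> fg; apply/val_inj/funext. Qed.

Fact formal_suppP f : exists (B : set K) (N : int),
  finite_set B /\ forall c, f c != 0 -> B c.1 /\ N <= c.2.
Proof. by apply/asboolP; case: f. Qed.

Fact formal_supp0 : formal_supp (fun=> 0).
Proof. by apply/asboolP; exists set0, 0; split => // c; rewrite eqxx. Qed.
Fact formal_suppD f g : formal_supp (fun c => f c + g c).
Proof.
have [B [N [Bf fP]]] := formal_suppP f; have [C [M [Cf gP]]] := formal_suppP g.
apply/asboolP; exists (B `|` C), (Order.min N M); split.
  by rewrite finite_setU.
move=> c; have [->|/fP[Bc Nc] _] := eqVneq (f c) 0.
  by rewrite add0r => /gP[Cc Mc]; split; [right|rewrite ge_min Mc orbT].
by split; [left|rewrite ge_min Nc].
Qed.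
Fact formal_suppN f : formal_supp (fun c => - f c).
Proof.
have [B [N [Bf fP]]] := formal_suppP f.
by apply/asboolP; exists B, N; split => // c; rewrite oppr_eq0; exact: fP.
Qed.

Definition formal_add f g := Formal (formal_suppD f g).
Definition formal_opp f := Formal (formal_suppN f).

Fact formal_addA : associative formal_add.
Proof. by move=> f g h; apply: formalP => c; exact: addrA. Qed.
Fact formal_addC : commutative formal_add.
Proof. by move=> f g; apply: formalP => c; exact: addrC. Qed.
Fact formal_add0 : left_id (Formal formal_supp0) formal_add.
Proof. by move=> f; apply: formalP => c; exact: add0r. Qed.
Fact formal_addN : left_inverse (Formal formal_supp0) formal_opp formal_add.
Proof. by move=> f; apply: formalP => c; exact: addNr. Qed.

HB.instance Definition _ :=
  GRing.isZmodule.Build formal formal_addA formal_addC formal_add0 formal_addN.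

(** Convolution; the support condition makes all these sums finite. *)
Definition formal_mulc f g c := \sum_(u \in [set: K * int]) f u * g (c - u).

Let formal_mulcN0 f g c :
  formal_mulc f g c != 0 -> exists u, f u != 0 /\ g (c - u) != 0.
Proof.
apply: contra_neqP => /forallNP fg; apply: fsbig1 => u _; apply/eqP.
rewrite mulf_eq0; apply: contrapT => /negP; rewrite negb_or => /andP.
exact: fg.
Qed.

Fact formal_supp_mul f g : formal_supp (formal_mulc f g).
Proof.
have [B [N [Bf fP]]] := formal_suppP f; have [C [M [Cf gP]]] := formal_suppP g.
apply/asboolP; exists [set b + b' | b in B & b' in C], (N + M); split.
  exact: finite_image2.
move=> c /formal_mulcN0[u [/fP[Bu Nu] /gP[Cu Mu]]].
split; first by exists u.1 => //; exists (c.1 - u.1); rewrite // addrC subrK.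
by move: Nu Mu => /=; lia.
Qed.

Definition formal_mul f g := Formal (formal_supp_mul f g).

(** [x^n exp (- b / x)] *)
Fact formal_supp_mono c : formal_supp (fun u => (u == c)%:R).
Proof.
apply/asboolP; exists [set c.1], c.2; split; first exact: finite_set1.
by move=> u; have [->|_] := eqVneq u c; rewrite ?eqxx.
Qed.
Definition formal_mono c := Formal (formal_supp_mono c).

Fact formal_mulC : commutative formal_mul.
Proof.
move=> f g; apply: formalP => c /=; rewrite /formal_mulc.
rewrite (reindex_fsbigT (fun u => c - u)) /=; last first.
  by exists (fun u => c - u) => u; rewrite subKr.
by apply: eq_fsbigr => u _; rewrite subKr mulrC.
Qed.

Let finite_interval (N M : int) : finite_set [set n : int | N <= n <= M].
Proof.
apply: (@sub_finite_set _ _ ((fun k : nat => N + k%:Z) @` `I_`|M - N|.+1)).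
  by move=> n /= /andP[Nn nM]; exists `|n - N|%N; rewrite /=; lia.
exact/finite_image/finite_II.
Qed.

Let formal_mul_finite f g c : finite_set [set u | f u != 0 /\ g (c - u) != 0].
Proof.
have [B [N [Bf fP]]] := formal_suppP f; have [C [M [Cf gP]]] := formal_suppP g.
apply: (@sub_finite_set _ _ (B `*` [set n : int | N <= n <= c.2 - M])).
  move=> u /= [/fP[Bu Nu] /gP[_ Mu]]; split => //=.
  by rewrite Nu /= lerBrDr addrC -lerBrDr.
exact: finite_setX.
Qed.

Let formal_mulE f g c (D : set (K * int)) :
  [set u | f u != 0 /\ g (c - u) != 0] `<=` D ->
  formal_mul f g c = \sum_(u \in D) f u * g (c - u).
Proof.
move=> sD; rewrite /= /formal_mulc -(@fsbig_widen _ _ _ _ D) // => u [_ Du] /=.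
apply: contrapT => /eqP; rewrite mulf_eq0 negb_or => /andP fg.
by apply: Du; exact: sD.
Qed.

Let formal_mulCA f g h :
  formal_mul f (formal_mul g h) = formal_mul g (formal_mul f h).
Proof.
apply: formalP => c.
have key f1 g1 : exists2 D : set (K * int), finite_set D &
    forall u v, f1 u != 0 -> g1 v != 0 -> h (c - u - v) != 0 -> D u.
  have [B [N [Bf fP]]] := formal_suppP f1.
  have [C [M [Cf gP]]] := formal_suppP g1.
  have [E [L [Ef hP]]] := formal_suppP h.
  exists (B `*` [set n : int | N <= n <= c.2 - M - L]).
    exact: finite_setX.
  move=> u v /fP[Bu Nu] /gP[_ Mv] /hP[_ /= Lw]; split => //=.
  by rewrite Nu /=; lia.
have [D Df DP] := key f g; have [E Ef EP] := key g f.
have expand f1 g1 (A A' : set (K * int)) : finite_set A -> finite_set A' ->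
    (forall u v, f1 u != 0 -> g1 v != 0 -> h (c - u - v) != 0 -> A u /\ A' v) ->
    formal_mul f1 (formal_mul g1 h) c =
    \sum_(u \in A) \sum_(v \in A') f1 u * (g1 v * h (c - u - v)).
  move=> Af A'f AP.
  rewrite (@formal_mulE _ _ _ A) => [|u /= [fu /formal_mulcN0[v [gv hv]]]];
    last first.
    by have [] := AP u v fu gv hv.
  apply: eq_fsbigr => u _; rewrite -mulr_fsumr.
  have [->|fu] := eqVneq (f1 u) 0; first by rewrite !mul0r.
  rewrite (@formal_mulE _ _ _ A') // => v /= [gv hv].
  by have [] := AP u v fu gv hv.
rewrite (expand _ _ D E) // => [|u v fu gv huv]; last first.
  split; first exact: DP huv.
  by apply: (EP v u) => //; rewrite addrAC.
rewrite (expand _ _ E D) // => [|u v gu fv huv]; last first.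
  split; first exact: EP huv.
  by apply: (DP v u) => //; rewrite addrAC.
rewrite exchange_fsbig //; apply: eq_fsbigr => u _; apply: eq_fsbigr => v _.
by rewrite mulrCA addrAC.
Qed.

Fact formal_mulA : associative formal_mul.
Proof. by move=> f g h; rewrite (formal_mulC g) formal_mulCA formal_mulC. Qed.

Fact formal_mul1 : left_id (formal_mono 0) formal_mul.
Proof.
move=> f; apply: formalP => c.
rewrite (@formal_mulE _ _ _ [set 0]) => [|u /= []].
  by rewrite fsbig_set1 /= eqxx mul1r subr0.
by have [->|_] := eqVneq u 0; rewrite ?eqxx.
Qed.

Fact formal_mulDl : left_distributive formal_mul formal_add.
Proof.
move=> f g h; apply: formalP => c.
pose D := [set u | f u != 0 /\ h (c - u) != 0] `|`
  [set u | g u != 0 /\ h (c - u) != 0].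
have Df : finite_set D by rewrite finite_setU; split.
rewrite (@formal_mulE _ _ _ D) => [|u /= [fgu hu]]; last first.
  have [fu|fu] := eqVneq (f u) 0; last by left.
  by right; split => //; rewrite fu add0r in fgu.
rewrite [RHS]/= -![formal_mulc _ _ c]/(formal_mul _ _ c).
rewrite (@formal_mulE f _ _ D) => [|u fu]; last by left.
rewrite (@formal_mulE g _ _ D) => [|u gu]; last by right.
by rewrite -fsbig_split //; apply: eq_fsbigr => u _; rewrite mulrDl.
Qed.

Fact formal_1neq0 : formal_mono 0 != 0 :> formal.
Proof.
apply/eqP => /(congr1 (fun f : formal => f 0)) /eqP /=.
by rewrite eqxx oner_eq0.
Qed.

HB.instance Definition _ := GRing.Zmodule_isComNzRing.Build formal
  formal_mulA formal_mulC formal_mul1 formal_mulDl formal_1neq0.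

Lemma formal_coeffM f g c :
  (f * g) c = \sum_(u \in [set: K * int]) f u * g (c - u).
Proof. by []. Qed.

Lemma formal_monoM u v : formal_mono u * formal_mono v = formal_mono (u + v).
Proof.
apply: formalP => c; rewrite [LHS](@formal_mulE _ _ _ [set u]) => [|w /= []].
  by rewrite fsbig_set1 /= eqxx mul1r subr_eq addrC.
by have [->|_] := eqVneq w u; rewrite ?eqxx.
Qed.

(** Termwise [d/dx], where
    [d/dx (x^n exp (- b / x)) = (n x^(n-1) + b x^(n-2)) exp (- b / x)]. *)
Definition formal_derivc f c :=
  (c.2 + 1)%:~R * f (c + (0, 1)) + c.1 * f (c + (0, 2)).

Let formal_supp_shift (l : K * int -> K) (n : int) f :
  formal_supp (fun c => l (c + (0, n)) * f (c + (0, n))).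
Proof.
have [B [N [Bf fP]]] := formal_suppP f.
apply/asboolP; exists B, (N - n); split => // c.
rewrite mulf_eq0 negb_or => /andP[_ /fP[/= Bc Nc]].
by rewrite addr0 in Bc; split => //; lia.
Qed.

Let formal_shift l n f := Formal (formal_supp_shift l n f).

Fact formal_supp_deriv f : formal_supp (formal_derivc f).
Proof.
have := formal_suppD (formal_shift (fun c => c.2%:~R) 1 f)
                     (formal_shift (fun c => c.1) 2 f).
congr formal_supp; apply/funext => c.
by rewrite /= /formal_derivc addr0.
Qed.

Definition formal_deriv f := Formal (formal_supp_deriv f).

Lemma formal_derivD f g :
  formal_deriv (f + g) = formal_deriv f + formal_deriv g.
Proof.
by apply: formalP => c; rewrite /= /formal_derivc /= !mulrDr addrACA.
Qed.

Let shift_leibniz (l : K * int -> K) (e : K * int) f g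
    (f' g' : K * int -> K) c :
  {morph l : u v / u + v} ->
  (forall u, f' u = l (u + e) * f (u + e)) ->
  (forall u, g' u = l (u + e) * g (u + e)) ->
  l (c + e) * (f * g) (c + e) =
  \sum_(u \in [set: K * int]) f' u * g (c - u) +
  \sum_(u \in [set: K * int]) f u * g' (c - u).
Proof.
move=> lD f'E g'E; pose D := [set u | f u != 0 /\ g (c + e - u) != 0].
have Df : finite_set D by exact: formal_mul_finite.
have restr (F : K * int -> K) : (forall u, F u != 0 -> D u) ->
    \sum_(u \in [set: K * int]) F u = \sum_(u \in D) F u.
  move=> FD; rewrite -(@fsbig_widen _ _ _ _ D) // => u [_ Du] /=.
  by apply: contrapT => /eqP /FD.
rewrite (@reindex_fsbigT _ _ _ _ _ (fun u => u - e)); last first.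
  by exists (fun u => u + e) => u; rewrite ?subrK ?addrK.
rewrite formal_coeffM !restr => [|u|u|u]; rewrite ?mulf_eq0 ?negb_or;
  last 3 first.
- by rewrite g'E mulf_eq0 negb_or => /and3P[fu _ gu]; rewrite /D /= addrAC.
- rewrite f'E subrK mulf_eq0 negb_or -andbA => /and3P[_ fu gu].
  by split => //; rewrite opprB addrA in gu.
- by move=> /andP[].
rewrite -fsbig_split // mulr_fsumr; apply: eq_fsbigr => u _.
rewrite f'E g'E subrK opprB (addrC e) addrA [c - u + e]addrAC.
have -> : l (c + e) = l u + l (c + e - u) by rewrite -lD (addrC u) subrK.
by rewrite /=; ring.
Qed.

Lemma formal_derivM f g :
  formal_deriv (f * g) = formal_deriv f * g + f * formal_deriv g.
Proof.
apply: formalP => c.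
pose l1 (u : K * int) : K := u.2%:~R.
have derE h : formal_deriv h = formal_shift l1 1 h + formal_shift fst 2 h.
  by apply: formalP => v; rewrite /= /formal_derivc /= addr0.
rewrite !derE mulrDl mulrDr addrACA; congr (_ + _).
  exact: (@shift_leibniz l1 (0, 1) _ _ _ _ c (fun u v => rmorphD _ _ _)
    (fun=> erefl) (fun=> erefl)).
exact: (@shift_leibniz fst (0, 2) _ _ _ _ c (fun u v => erefl)
    (fun=> erefl) (fun=> erefl)).
Qed.

(** Embedding of K[[x]]. *)
Definition of_fpsc (h : fps K) (c : K * int) : K :=
  match c.2 with
  | Posz n => if c.1 == 0 then h n else 0
  | Negz _ => 0
  end.

Fact formal_supp_of_fps (h : fps K) : formal_supp (of_fpsc h).
Proof.
apply/asboolP; exists [set 0], 0; split; first exact: finite_set1.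
case=> b [n|n]; rewrite /of_fpsc /= ?eqxx //.
by have [->|] := eqVneq b 0; rewrite ?eqxx.
Qed.

Definition of_fps (h : fps K) := Formal (formal_supp_of_fps h).

Fact of_fps_is_zmod_morphism : zmod_morphism of_fps.
Proof.
move=> h k; apply: formalP => -[b [n|n]]; rewrite /= /of_fpsc /= ?subr0 //.
by case: ifP; rewrite ?subr0.
Qed.
HB.instance Definition _ :=
  GRing.isZmodMorphism.Build (fps K) formal of_fps of_fps_is_zmod_morphism.

Fact of_fps_is_monoid_morphism : monoid_morphism of_fps.
Proof.
split.
  apply: formalP => -[b [n|n]]; rewrite /= /of_fpsc /= -pair_eqE /= ?andbF //.
  by case: eqP => // _; case: n.
move=> h k; apply: formalP => -[b n].
pose D := (fun i : nat => (0, i%:Z)) @` `I_`|n|.+1 : set (K * int).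
rewrite [RHS](@formal_mulE _ _ _ D) => [|[b1 [i|i]]];
  rewrite /= /of_fpsc /= ?eqxx; last 2 first.
- have [->|_ []] := eqVneq b1 0; rewrite ?eqxx // subr0 => -[_].
  case E : (n - i%:Z) => [j|j]; rewrite ?eqxx // => _.
  by exists i => //=; lia.
- by case.
rewrite fsbig_image => [|i j _ _ [] //]; rewrite -fsbig_ord /=.
case: n @D => [n|n] D.
  have [->|b0] := eqVneq b 0; last first.
    rewrite big1 // => i _; rewrite subr0 (negbTE b0).
    by case: (_ - _) => *; rewrite mulr0.
  apply: eq_bigr => i _; rewrite eqxx subr0 eqxx.
  by have -> : n%:Z - i%:Z = (n - i)%N%:Z by have := ltn_ord i; lia.
rewrite big1 // => i _.
by have -> : Negz n - i%:Z = Negz (n + i)%N; [lia|rewrite mulr0].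
Qed.
HB.instance Definition _ :=
  GRing.isMonoidMorphism.Build (fps K) formal of_fps of_fps_is_monoid_morphism.

Lemma of_fps_deriv (h : fps K) : formal_deriv (of_fps h) = of_fps (fps_deriv h).
Proof.
apply: formalP => -[b n].
have E m : of_fps h ((b, n) + (0, m)) = of_fpsc h (b, n + m).
  by rewrite /= /of_fpsc /= addr0.
rewrite [LHS]/= /formal_derivc !E /= /of_fpsc /=.
have -> : b * match n + 2 with
    Posz m => if b == 0 then h m else 0 | Negz _ => 0 end = 0.
  case: (n + 2) => *; rewrite ?mulr0 //.
  by case: eqP => [->|_]; rewrite ?mul0r ?mulr0.
rewrite {E} addr0; case: n => [n|[|n]].
- rewrite addrC; case: ifP; rewrite ?mulr0 // => _.
  by rewrite mulr_natl.
- by rewrite mul0r.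
have -> : Negz n.+1 + 1 = Negz n by lia.
by rewrite mulr0.
Qed.

Lemma of_fps_constM (a : K) g c : (of_fps (fps_const a) * g) c = a * g c.
Proof.
rewrite [LHS](@formal_mulE _ _ _ [set 0]) => [|[b [[|n]|n]] []].
- by rewrite fsbig_set1 /= /of_fpsc /= eqxx subr0.
- by rewrite /= /of_fpsc /=; have [->|_] := eqVneq b 0; rewrite ?eqxx.
- by rewrite /= /of_fpsc /=; case: ifP; rewrite eqxx.
- by rewrite /= /of_fpsc /= eqxx.
Qed.

Lemma formal_deriv_mono (b : K) (n : int) :
  formal_deriv (formal_mono (b, n)) =
  of_fps (fps_const n%:~R) * formal_mono (b, n - 1) +
  of_fps (fps_const b) * formal_mono (b, n - 2).
Proof.
apply: formalP => c.
rewrite [RHS](congr2 +%R (of_fps_constM _ _ _) (of_fps_constM _ _ _)).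
have E m : ((c + (0, m)) == (b, n)) = (c == (b, n - m)).
  case: c => c1 c2; rewrite -!pair_eqE /= /pair_eq /= addr0; congr (_ && _).
  by rewrite eq_sym -subr_eq eq_sym.
rewrite [LHS]/= /formal_derivc /= !E.
congr (_ + _); case: eqP => [->|_]; rewrite ?mulr0 //= ?subrK //.
Qed.
End FormalFunctions.

Definition mx2 (T : Type) (a b c d : T) : 'M[T]_2 :=
  \matrix_(i < 2, j < 2)
    if i == 0 then if j == 0 then a else b else if j == 0 then c else d.

Section Equation.
Variables (K : fieldType) (beta1 beta2 gamma1 gamma2 : K).

Local Notation cst c := (of_fps (fps_const c)).
Local Notation xpow n := (formal_mono (0, n)).
Local Notation exp c := (of_fps (fps_exp c)).
Local Notation expinv b := (formal_mono (b, 0)).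

Definition L1 (y : formal K) : formal K :=
  formal_deriv y - (cst beta1 * xpow (- 2) + cst gamma1) * y.

Definition L2 (y : formal K) : formal K :=
  formal_deriv y
  - (cst (- 2) * xpow (- 1) + cst beta2 * xpow (- 2) + cst gamma2) * y.

(** Fundamental matrix of [L2 (L1 y) = 0], for the vector unknown
    [(y, L1 y)]. *)
Definition fundamental_matrix (Phi : 'M[formal K]_2) : Prop :=
  [/\ forall j, L2 (L1 (Phi 0 j)) = 0,
      forall j, Phi 1 j = L1 (Phi 0 j)
    & exists Psi : 'M[formal K]_2, Phi *m Psi = 1%:M].

Definition Phi1 : formal K := exp gamma1 * expinv beta1.
Definition Phi2 : formal K := xpow (- 2) * exp gamma2 * expinv beta2.

(** [J] is the formal counterpart of the integral of [Phi2 / Phi1]. *)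
Definition triangular_form (Phi : 'M[formal K]_2) : Prop :=
  exists J : formal K, Phi1 * formal_deriv J = Phi2 /\
    Phi = mx2 Phi1 (Phi1 * J) 0 Phi2.

Definition formal_fundamental_matrix (Phi : 'M[formal K]_2) : Prop :=
  fundamental_matrix Phi /\ triangular_form Phi.

(** [exp (G x) H(x) x^Lambda exp (- B / x)] *)
Definition normal_form (H : 'M[fps K]_2) : 'M[formal K]_2 :=
  mx2 (exp gamma1) 0 0 (exp gamma2) *m map_mx (@of_fps K) H
  *m mx2 (xpow 0) 0 0 (xpow (- 2)) *m mx2 (expinv beta1) 0 0 (expinv beta2).

End Equation.

(** In this section [beta] stands for [beta2 - beta1] and [gamma] for
    [gamma2 - gamma1]. *)
Section Coefficients.
Variables (K : fieldType) (beta gamma : K).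

Definition S_term (n : nat) : K :=
  (- 1) ^+ n.+1 * gamma ^+ n * beta ^+ n / (n`!%:R * n.+1`!%:R).

(** [series S_term k] is the sum of the terms of index [0, ..., k - 1]. *)
Definition psi_hat : fps K :=
  Fps (fun k => if k is 0%N then 0 else
    (- 1) ^+ k * k`!%:R * series S_term k / beta ^+ k).

Definition H_hat (psi : fps K) : 'M[fps K]_2 :=
  mx2 1
      (fps_const beta^-1 * fps_X K ^+ 2 * fps_exp gamma
       - fps_const (gamma / beta) * fps_X K ^+ 3 * psi)
      0 1.

End Coefficients.

(** When [gamma = 0] all the partial sums are [- 1], so [psi_hat] is the
    divergent series [\sum_(k >= 1) (- 1) ^ (k + 1) k! (x / beta) ^ k]; its
    leading term is [x / beta], but it is not equal to it. *)
Lemma psi_hat_gamma0 (K : numFieldType) (beta : K) : beta != 0 ->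
  psi_hat beta 0 <> fps_const beta^-1 * fps_X K.
Proof.
move=> beta0 /(congr1 (fun f : fps K => f 2%N)) /eqP.
have -> : psi_hat beta 0 2 = - 2 / beta ^+ 2.
  rewrite /psi_hat /= /series /= !big_nat_recl // big_geq // /S_term.
  rewrite !expr0 !expr1 !mulr0 !mul0r !addr0 !mulr1 divr1 sqrrN expr1n.
  by rewrite mul1r mulrN1.
rewrite fps_coefM !big_ord_recl big_ord0 /= !mulr0 !mul0r !addr0.
by rewrite mulf_eq0 oppr_eq0 pnatr_eq0 invr_eq0 expf_eq0 (negbTE beta0).
Qed.

Section Convergence.
Variable K : numFieldType.

Definition absolutely_convergent (u : nat -> K) : Prop :=
  cvgn [normed series u].

Definition series_converges_to (u : nat -> K) (l : K) : Prop :=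
  series u @ \oo --> l.

Definition S_sum (beta gamma : K) : K := limn (series (S_term beta gamma)).

Definition fps_terms (f : fps K) (z : K) : nat -> K := fun k => f k * z ^+ k.

Definition fps_divergent (f : fps K) : Prop :=
  forall z : K, z != 0 -> ~ cvgn (series (fps_terms f z)).

(** [f] represents a function analytic on the whole of [K] ([K] is R[i] in
    the applications, where [derivable F z 1] is complex differentiability). *)
Definition fps_entire (f : fps K) : Prop :=
  exists F : K -> K, (forall z, derivable F z 1) /\
    forall z, series_converges_to (fps_terms f z) (F z).

End Convergence.

(* Main.v *)
Require Import Defs.
From mathcomp Require Import all_boot all_order all_algebra.
From mathcomp Require Import all_classical all_reals all_analysis.
From mathcomp Require Import complex ring.

Set Implicit Arguments.
Unset Strict Implicit.
Unset Printing Implicit Defensive.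

Import Order.TTheory GRing.Theory Num.Theory numFieldNormedType.Exports.
Local Open Scope classical_set_scope.
Local Open Scope ring_scope.
Local Open Scope complex_scope.

(** A triangular fundamental matrix of the form [exp (G x) H x^Lambda exp (- B / x)]
    has [J = h x^-2 exp (- beta / x)] as its integral, [h] being the upper right
    entry of [H], and then [J' = Phi2 / Phi1] amounts to the equation
    [x^2 h' - 2 x h + beta h = x^2 exp (gamma x)]. As [beta != 0], its
    coefficients are determined recursively. In terms of [psi] it becomes
    [beta psi + x psi + x^2 psi' = x exp (gamma x)], which is the recursion of
    the partial sums of [S].

    If the series [psi] converges at some [z != 0], its terms tend to [0]; the
    products of these with the terms of the exponential series at [- beta / z]
    are the partial sums of [S], so [S = 0]. Conversely, if [S = 0] the partial
    sums are minus the tails, whose decay gives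
    [|psi_k| <= exp (|beta gamma|) |gamma|^k / k!]. *)

(** * Coefficients, derivatives and exponentials of formal power series *)

Section PowerSeries.
Variable K : numFieldType.
Implicit Types (f : fps K) (c d : K).

Lemma fps_coef_constM c f n : (fps_const c * f) n = c * f n.
Proof.
rewrite fps_coefM big_ord_recl subn0 /= big1 ?addr0 // => i _.
by rewrite mul0r.
Qed.

Lemma fps_coefXM f n : (fps_X K * f) n = if n is m.+1 then f m else 0.
Proof.
case: n => [|n]; first by rewrite fps_coefM big_ord1 mul0r.
rewrite fps_coefM !big_ord_recl mul0r add0r mul1r subSS subn0.
by rewrite big1 ?addr0 // => i _; rewrite mul0r.
Qed.

Lemma fps_const_M c d : fps_const (c * d) = fps_const c * fps_const d.
Proof.
by apply: fpsP => -[|n]; rewrite fps_coef_constM //= mulr0.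
Qed.

Lemma fps_const_nat n : fps_const n%:R = n%:R :> fps K.
Proof.
elim: n => [|n IH]; first by apply: fpsP => -[].
rewrite -[RHS]natr1 -IH -natr1; apply: fpsP => -[|m] //.
by rewrite fps_coefD /= addr0.
Qed.

Lemma fps_const_opp c : fps_const (- c) = - fps_const c.
Proof. by apply: fpsP => -[|n]; rewrite fps_coefN //= oppr0. Qed.

Lemma fps_deriv_const c : fps_deriv (fps_const c) = 0.
Proof. by apply: fpsP => n; rewrite /= mul0rn. Qed.

Lemma fps_derivX : fps_deriv (fps_X K) = 1.
Proof. by apply: fpsP => -[|n]; rewrite /= ?mul0rn. Qed.

Lemma fps_deriv_exp c : fps_deriv (fps_exp c) = fps_const c * fps_exp c.
Proof.
apply: fpsP => n; rewrite fps_coef_constM /= exprS factS natrM.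
have n0 : n`!%:R != 0 :> K by rewrite pnatr_eq0 -lt0n fact_gt0.
have n1 : n.+1%:R != 0 :> K by rewrite pnatr_eq0.
rewrite -[LHS]mulr_natr; move: n0 n1; move: (n.+1%:R : K) (n`!%:R : K) => a b b0 a0.
by field; rewrite ?a0 ?b0.
Qed.

Lemma fps_exp0 : fps_exp 0 = 1 :> fps K.
Proof. by apply: fpsP => -[|n]; rewrite /= ?expr0 ?divr1 // expr0n mul0r. Qed.

Lemma fps_expD c d : fps_exp (c + d) = fps_exp c * fps_exp d.
Proof.
apply: fpsP => n; rewrite fps_coefM /= addrC exprDn mulr_suml.
apply: eq_bigr => i _.
have in_ : (i <= n)%N by rewrite -ltnS.
have f0 k : k`!%:R != 0 :> K by rewrite pnatr_eq0 -lt0n fact_gt0.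
have /(congr1 (fun k => k%:R : K)) := bin_fact in_.
rewrite !natrM -mulr_natr => <-.
by field; rewrite !f0 /=; move: (bin_gt0 n i); rewrite in_ pnatr_eq0 -lt0n.
Qed.

End PowerSeries.

(** * Units and monomials among the formal functions *)

Section FormalSolution.
Variable K : numFieldType.
Implicit Types (f h : fps K) (b c : K).

Lemma of_fps_inj : injective (@of_fps K).
Proof.
move=> f h /(congr1 (fun F : formal K => F (0, Posz _))) E.
by apply: fpsP => n; have := E n; rewrite /= /of_fpsc /= eqxx.
Qed.

Lemma of_fpsX : of_fps (fps_X K) = formal_mono (0, 1).
Proof.
apply: formalP => -[b [n|n]]; rewrite /= /of_fpsc /= -pair_eqE /= ?andbF //.
by case: eqP => // _.
Qed.

Lemma formal_mono0 : formal_mono (0, 0) = 1 :> formal K.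
Proof. by []. Qed.

Lemma formal_monoD b c (m n : int) :
  formal_mono (b, m) * formal_mono (c, n) = formal_mono (b + c, m + n).
Proof. exact: formal_monoM. Qed.

Lemma formal_monoV b (n : int) : formal_mono (b, n) * formal_mono (- b, - n) = 1.
Proof.
by rewrite formal_monoD !subrr.
Qed.

Lemma of_fps_expV c : of_fps (fps_exp c) * of_fps (fps_exp (- c)) = 1.
Proof. by rewrite -rmorphM -fps_expD subrr fps_exp0 rmorph1. Qed.

End FormalSolution.

(** * Two-by-two matrices by their entries *)

Section TwoByTwo.

Lemma mx2M (T : pzRingType) (a b c d a' b' c' d' : T) :
  mx2 a b c d *m mx2 a' b' c' d' =
  mx2 (a * a' + b * c') (a * b' + b * d') (c * a' + d * c') (c * b' + d * d').
Proof.
apply/matrixP => i j; rewrite !mxE !big_ord_recl big_ord0 addr0 !mxE.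
by case: i => [[|[|]]] //= ?; case: j => [[|[|]]] //= ?.
Qed.

Lemma mx2_1 (T : pzRingType) : mx2 1 0 0 1 = 1%:M :> 'M[T]_2.
Proof.
apply/matrixP => i j; rewrite !mxE.
by case: i => [[|[|]]] //= ?; case: j => [[|[|]]] //= ?.
Qed.

Lemma mx2_eta (T : Type) (A : 'M[T]_2) : A = mx2 (A 0 0) (A 0 1) (A 1 0) (A 1 1).
Proof.
apply/matrixP => i j; rewrite !mxE.
by case: i => [[|[|]]] //= ?; case: j => [[|[|]]] //= ?; congr (A _ _); apply: val_inj.
Qed.

Lemma mx2_map (T U : Type) (f : T -> U) (a b c d : T) :
  map_mx f (mx2 a b c d) = mx2 (f a) (f b) (f c) (f d).
Proof.
apply/matrixP => i j; rewrite !mxE.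
by case: i => [[|[|]]] //= ?; case: j => [[|[|]]] //= ?.
Qed.

End TwoByTwo.

(** * The normal form and the equation of its upper right entry *)

Section FundamentalMatrix.
Variables (K : numFieldType) (beta1 beta2 gamma1 gamma2 : K).
Local Notation beta := (beta2 - beta1).
Local Notation gamma := (gamma2 - gamma1).
Local Notation X := (fps_X K).
Local Notation mono b n := (formal_mono (b, n)).
Local Notation normal_form := (normal_form beta1 beta2 gamma1 gamma2).
Local Notation Phi1 := (Phi1 beta1 gamma1).
Local Notation Phi2 := (Phi2 beta2 gamma2).

(** The three factors around [H] are invertible diagonal matrices of formal functions, and [of_fps]
    is injective, so [H] can be recovered. *)
Lemma normal_form_inj : injective normal_form.
Proof.
pose El := mx2 (of_fps (fps_exp (- gamma1))) 0 0 (of_fps (fps_exp (- gamma2))).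
pose Ir := mx2 (mono (- beta1) 0) 0 0 (mono (- beta2) 0 : formal K).
pose xr := mx2 (mono 0 0) 0 0 (mono 0 2 : formal K).
have cancel_l : El *m mx2 (of_fps (fps_exp gamma1)) 0 0 (of_fps (fps_exp gamma2)) = 1%:M.
  rewrite mx2M !(mulr0, mul0r, addr0, add0r) -mx2_1.
  by congr (mx2 _ _ _ _); rewrite mulrC of_fps_expV.
have cancel_r : mx2 (mono beta1 0) 0 0 (mono beta2 0) *m Ir = 1%:M.
  rewrite mx2M !(mulr0, mul0r, addr0, add0r) -mx2_1.
  congr (mx2 _ _ _ _); first by rewrite -(formal_monoV beta1 0) oppr0.
  by rewrite -(formal_monoV beta2 0) oppr0.
have cancel_x : mx2 (mono 0 0) 0 0 (mono 0 (- 2)) *m xr = 1%:M.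
  rewrite mx2M !(mulr0, mul0r, addr0, add0r) -mx2_1.
  congr (mx2 _ _ _ _); first by rewrite !formal_mono0 mulr1.
  by rewrite -(formal_monoV 0 (- 2)) oppr0 opprK.
have inv H : El *m normal_form H *m Ir *m xr = map_mx (@of_fps K) H.
  rewrite /normal_form !mulmxA cancel_l mul1mx.
  by rewrite -[_ *m _ *m Ir]mulmxA cancel_r mulmx1 -mulmxA cancel_x mulmx1.
move=> H H' /(congr1 (fun M => El *m M *m Ir *m xr)); rewrite !inv.
by move/matrixP=> E; apply/matrixP => i j; apply: of_fps_inj; have := E i j; rewrite !mxE.
Qed.

Let Phi1V := of_fps (fps_exp (- gamma1)) * mono (- beta1) (- 0).

Let Phi1K : Phi1V * Phi1 = 1.
Proof.
have -> : Phi1V * Phi1 =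
    (of_fps (fps_exp gamma1) * of_fps (fps_exp (- gamma1))) *
    (mono beta1 0 * mono (- beta1) (- 0)) by rewrite /Phi1V /Defs.Phi1; ring.
by rewrite of_fps_expV formal_monoV mulr1.
Qed.

Lemma Phi1_mulI : injective ( *%R Phi1).
Proof. by move=> f g /= E; rewrite -[f]mul1r -[g]mul1r -Phi1K -!(mulrA Phi1V) E. Qed.

Lemma normal_formE (H : 'M[fps K]_2) :
  let e1 := of_fps (fps_exp gamma1) in let e2 := of_fps (fps_exp gamma2) in
  normal_form H =
  mx2 (e1 * of_fps (H 0 0) * mono beta1 0) (e1 * of_fps (H 0 1) * mono beta2 (- 2))
      (e2 * of_fps (H 1 0) * mono beta1 0) (e2 * of_fps (H 1 1) * mono beta2 (- 2)).
Proof.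
rewrite /= /normal_form {1}(mx2_eta H) mx2_map !mx2M.
rewrite !(mulr0, mul0r, addr0, add0r) formal_mono0 !mulr1.
have -> : mono beta2 (- 2) = mono 0 (- 2) * mono beta2 0.
  by rewrite formal_monoD add0r addr0.
by rewrite !mulrA.
Qed.

(** Differentiating [x^-2 exp (- beta / x)] produces powers of [x] down to [x^-4]. Both sides of the
    first equation are therefore the unit [Phi1 * x^-4 exp (- beta / x)] times a power series, and
    cancelling this unit leaves the second equation. *)
Lemma deriv_integralE (h : fps K) :
  Phi1 * formal_deriv (of_fps h * mono beta (- 2)) = Phi2 <->
  X ^+ 2 * fps_deriv h - 2 * X * h + fps_const beta * h = X ^+ 2 * fps_exp gamma.
Proof.
have monoX n : mono beta (- 4 + n%:Z) = of_fps (X ^+ n) * mono beta (- 4).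
  have -> : of_fps (X ^+ n) = mono 0 n%:Z.
    elim: n => [|n IH]; first by rewrite rmorph1.
    by rewrite exprS rmorphM /= IH of_fpsX formal_monoD addr0 intS.
  by rewrite formal_monoD add0r addrC.
have derE : Phi1 * formal_deriv (of_fps h * mono beta (- 2)) = Phi1 * mono beta (- 4) *
    of_fps (X ^+ 2 * fps_deriv h - 2 * X * h + fps_const beta * h).
  rewrite formal_derivM of_fps_deriv formal_deriv_mono.
  have -> : mono beta (- 2) = of_fps X ^+ 2 * mono beta (- 4).
    by rewrite -rmorphXn; exact: (monoX 2).
  have -> : mono beta (- 2 - 1) = of_fps X * mono beta (- 4) by exact: (monoX 1).
  have -> : mono beta (- 2 - 2) = mono beta (- 4) by [].
  have -> : (- 2)%:~R = - 2%:R :> K by [].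
  rewrite !expr2 fps_const_opp fps_const_nat rmorphD rmorphB rmorphN !rmorphM rmorph_nat /=.
  by ring.
have Phi2E : Phi2 = Phi1 * mono beta (- 4) * of_fps (X ^+ 2 * fps_exp gamma).
  have -> : Phi2 = of_fps (fps_exp gamma1 * fps_exp gamma) * (mono 0 (- 2) * mono beta2 0).
    by rewrite -fps_expD addrC subrK /Defs.Phi2; ring.
  have -> : mono 0 (- 2) * mono beta2 0 = mono beta1 0 * mono beta (- 4 + 2).
    by rewrite !formal_monoD addr0 !add0r addrC subrK.
  by rewrite (monoX 2) !rmorphM /Defs.Phi1; ring.
rewrite derE Phi2E; split=> [E|-> //].
move: E; rewrite -!(mulrA Phi1) => /Phi1_mulI E.
have can F : F = mono beta (- 4) * F * mono (- beta) (- - 4).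
  by rewrite mulrAC formal_monoV mul1r.
by apply: of_fps_inj; rewrite [LHS]can [RHS]can E.
Qed.

(** The left side has coefficient [b h_0] at index [0] and [(n - 2) h_n + b h_(n+1)] at index
    [n + 1]; as [b != 0], each coefficient of [h] is fixed by the preceding one. *)
Lemma entry_eq_uniq (b : K) (g h k : fps K) : b != 0 ->
  X ^+ 2 * fps_deriv h - 2 * X * h + fps_const b * h = g ->
  X ^+ 2 * fps_deriv k - 2 * X * k + fps_const b * k = g -> h = k.
Proof.
move=> b0 hE kE; apply: fpsP => n.
have coefE f m : (X ^+ 2 * fps_deriv f - 2 * X * f + fps_const b * f) m =
    (if m is m'.+1 then
       (if m' is m''.+1 then f m''.+1 *+ m''.+1 else 0) - f m' *+ 2
     else 0) + b * f m.
  rewrite !fps_coefD fps_coefN expr2 -!mulrA fps_coefXM fps_coef_constM; congr (_ + _).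
  have -> : 2 * (X * f) = X * f + X * f by ring.
  rewrite fps_coefD !fps_coefXM; case: m => [|m]; first by rewrite addr0 subr0.
  by rewrite fps_coefXM mulr2n; case: m.
elim: n => [|n IH]; have := congr1 (fun f : fps K => f _) (etrans hE (esym kE)).
  by move=> /(_ 0%N); rewrite !coefE !add0r => /(mulfI b0).
move=> /(_ n.+1); rewrite !coefE IH.
have -> : match n with 0 => 0 | m.+1 => h m.+1 *+ m.+1 end =
          match n with 0 => 0 | m.+1 => k m.+1 *+ m.+1 end :> K by case: n IH => // n ->.
by move=> /addrI/(mulfI b0).
Qed.

(** At index [n + 1] this reads [b psi_(n+1) + (n + 1) psi_n = c^n / n!]. The factor [- (n + 1) / b]
    turns the prefactor of [psi_n] into that of [psi_(n+1)], and the right side accounts for the one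
    new term of the partial sum. *)
Lemma psi_hatE (b c : K) : b != 0 ->
  fps_const b * psi_hat b c + X * psi_hat b c + X ^+ 2 * fps_deriv (psi_hat b c) =
  X * fps_exp c.
Proof.
move=> b0; apply: fpsP => n.
rewrite !fps_coefD expr2 -mulrA fps_coef_constM !fps_coefXM.
case: n => [|n]; first by rewrite /= mulr0 !addr0.
have -> : (X * fps_deriv (psi_hat b c)) n = psi_hat b c n *+ n.
  by rewrite fps_coefXM; case: n.
rewrite -addrA -mulrS [psi_hat b c n.+1]/= [fps_exp c n]/= seriesSr /S_term.
(* The closed formula also covers [n = 0], where the partial sum is empty. *)
have -> : psi_hat b c n *+ n.+1 = (- 1) ^+ n * n.+1`!%:R * series (S_term b c) n / b ^+ n.
  case: n => [|n]; first by rewrite /= /series /= big_geq // mulr0 mul0r.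
  by rewrite -[LHS]mulr_natr [psi_hat b c n.+1]/= [in RHS]factS natrM; ring.
have f0 k : k`!%:R != 0 :> K by rewrite pnatr_eq0 -lt0n fact_gt0.
have sign : (- 1) ^+ n * (- 1) ^+ n = 1 :> K by rewrite -expr2 sqrr_sign.
move: (f0 n) (f0 n.+1) (expf_neq0 n b0); rewrite !exprS.
move: (n`!%:R : K) (n.+1`!%:R : K) (b ^+ n) (series (S_term b c) n) (c ^+ n) sign.
move=> u v w s t; move: ((- 1) ^+ n : K) => e e2 u0 v0 w0.
have -> : b * (-1 * e * v * (s + -1 * e * t * w / (u * v)) / (b * w)) =
   - (e * v * s / w) + (e * e) * t / u by field; rewrite ?b0 ?u0 ?v0 ?w0.
by rewrite e2 mul1r addrC addrA subrr add0r.
Qed.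

(** For [h = (x^2 exp (c x) - c x^3 p) / b] the left side equals [x^2 exp (c x) + (c / b) x^3 (x exp
    (c x) - x p - x^2 p' - b p)], whose last bracket vanishes by the equation of [p]. *)
Lemma H_hat_entry_eq (b c : K) (p : fps K) : b != 0 ->
  fps_const b * p + X * p + X ^+ 2 * fps_deriv p = X * fps_exp c ->
  let h := H_hat b c p 0 1 in
  X ^+ 2 * fps_deriv h - 2 * X * h + fps_const b * h = X ^+ 2 * fps_exp c.
Proof.
move=> b0 pE /=; rewrite /H_hat !mxE /= fps_const_M.
have bV : fps_const b * fps_const b^-1 = 1 by rewrite -fps_const_M divff.
have dB f g : fps_deriv (f - g) = fps_deriv f - fps_deriv g :> fps K.
  by apply: fpsP => n; exact: mulrnBl.
rewrite !exprS !expr0 !mulr1 dB !fps_derivM !fps_deriv_const fps_derivX fps_deriv_exp.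
set bb := fps_const b; set b' := fps_const b^-1; set g := fps_const c.
set E := fps_exp c in pE *; set p' := fps_deriv p in pE *.
apply: (@etrans _ _ ((bb * b') * X ^+ 2 * E - (bb * b') * g * X ^+ 3 * p
   + g * b' * X ^+ 3 * (X * E - X * p - X ^+ 2 * p'))); first by ring.
have -> : X * E - X * p - X ^+ 2 * p' = bb * p by rewrite -pE /bb; ring.
rewrite (_ : g * b' * X ^+ 3 * (bb * p) = (bb * b') * g * X ^+ 3 * p); last by ring.
by rewrite subrK bV mul1r expr2.
Qed.

(** * Existence and uniqueness of the fundamental matrix in normal form *)

Hypothesis beta_neq : beta != 0.

(** Comparing upper right entries forces [J = h x^-2 exp (- beta / x)] with [h = H 0 1]. This
    excludes an additive integration constant, which would carry the exponent [0] instead of [beta];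
    the differential equation then leaves one choice of [h]. *)
Lemma triangular_normal_form (H : 'M[fps K]_2) :
  triangular_form beta1 beta2 gamma1 gamma2 (normal_form H) <->
  H = H_hat beta gamma (psi_hat beta gamma).
Proof.
have upper h : normal_form (mx2 1 h 0 1) =
    mx2 Phi1 (Phi1 * (of_fps h * mono beta (- 2))) 0 Phi2.
  rewrite normal_formE !mxE /= rmorph1 rmorph0 !mulr1 mulr0 mul0r.
  have -> : mono beta2 (- 2) = mono beta1 0 * mono beta (- 2).
    by rewrite formal_monoD add0r addrC subrK.
  congr (mx2 _ _ _ _); rewrite /Defs.Phi1 /Defs.Phi2; first by ring.
  rewrite formal_monoD add0r addrC subrK [mono 0 (- 2) * _]mulrC -mulrA.
  by rewrite formal_monoD add0r addr0.
have e01 h : (mx2 1 h 0 1 : 'M[fps K]_2) 0 1 = h by rewrite mxE.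
have entry (M M' : 'M[fps K]_2) : M 0 1 = M' 0 1 -> normal_form M 0 1 = normal_form M' 0 1.
  by move=> E; rewrite !normal_formE !mxE /= E.
have hatE := H_hat_entry_eq beta_neq (psi_hatE gamma beta_neq).
split=> [[J [PJ HE]]|->].
  have JE : Phi1 * J = Phi1 * (of_fps (H 0 1) * mono beta (- 2)).
    have e01' (a b c d : formal K) : mx2 a b c d 0 1 = b by rewrite mxE.
    rewrite -(e01' Phi1 (Phi1 * J) 0 Phi2) -HE.
    by rewrite (entry H (mx2 1 (H 0 1) 0 1)) ?upper ?e01' ?e01.
  (* By injectivity this settles the other three entries of [H]. *)
  have {}HE : normal_form H = normal_form (mx2 1 (H 0 1) 0 1).
    by rewrite HE JE upper.
  have hE : H 0 1 = H_hat beta gamma (psi_hat beta gamma) 0 1.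
    apply: entry_eq_uniq beta_neq _ hatE.
    by apply/deriv_integralE; rewrite -(Phi1_mulI JE).
  move/normal_form_inj: HE => ->.
  by rewrite hE [RHS]mx2_eta; congr (mx2 _ _ _ _); rewrite !mxE.
exists (of_fps (H_hat beta gamma (psi_hat beta gamma) 0 1) * mono beta (- 2)); split.
  exact/deriv_integralE.
rewrite -upper; congr normal_form.
by rewrite [LHS]mx2_eta; congr (mx2 _ _ _ _); rewrite !mxE.
Qed.

(** [L1] kills [Phi1], sends [Phi1 * J] to [Phi1 * J' = Phi2], and [L2] kills [Phi2]. The matrix is
    invertible because its diagonal entries are units. *)
Lemma triangular_fundamental (Phi : 'M[formal K]_2) :
  triangular_form beta1 beta2 gamma1 gamma2 Phi ->
  fundamental_matrix beta1 beta2 gamma1 gamma2 Phi.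
Proof.
move=> [J [PJ ->]].
have m0 b : mono b (0 - 2) = mono 0 (- 2) * mono b 0 :> formal K.
  by rewrite formal_monoD !add0r addr0.
have zconst : fps_const 0%:~R = 0 :> fps K by rewrite (fps_const_nat K 0).
have dPhi1 : formal_deriv Phi1 = (of_fps (fps_const beta1) * mono 0 (- 2) +
    of_fps (fps_const gamma1)) * Phi1.
  rewrite /Defs.Phi1 formal_derivM of_fps_deriv fps_deriv_exp formal_deriv_mono m0 zconst.
  by rewrite rmorph0 rmorphM /=; ring.
have dPhi2 : formal_deriv Phi2 = (of_fps (fps_const (- 2)) * mono 0 (- 1) +
    of_fps (fps_const beta2) * mono 0 (- 2) + of_fps (fps_const gamma2)) * Phi2.
  rewrite /Defs.Phi2 !formal_derivM of_fps_deriv fps_deriv_exp !formal_deriv_mono (m0 beta2) zconst.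
  have -> : (- 2)%:~R = - 2 :> K by [].
  have -> : mono 0 (- 2 - 1) = mono 0 (- 1) * mono 0 (- 2) :> formal K.
    by rewrite formal_monoD addr0.
  by rewrite !rmorph0 rmorphM /=; ring.
have L1Phi1 : L1 beta1 gamma1 Phi1 = 0 by rewrite /L1 dPhi1 subrr.
have L1J : L1 beta1 gamma1 (Phi1 * J) = Phi2.
  by rewrite /L1 formal_derivM dPhi1 -PJ; ring.
have L20 : L2 beta2 gamma2 0 = 0.
  rewrite /L2 mulr0 subr0.
  by rewrite -(rmorph0 (@of_fps K)) of_fps_deriv; congr of_fps; apply: fpsP => n; exact: mul0rn.
have L2Phi2 : L2 beta2 gamma2 Phi2 = 0 by rewrite /L2 dPhi2 subrr.
have L1E (j : 'I_2) : L1 beta1 gamma1 (mx2 Phi1 (Phi1 * J) 0 Phi2 0 j) = mx2 Phi1 (Phi1 * J) 0 Phi2 1 j.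
  by rewrite !mxE /=; case: eqP.
split=> [j|j|]; rewrite ?L1E //.
  by rewrite !mxE /=; case: eqP.
pose Phi2V := mono 0 (- - 2) * of_fps (fps_exp (- gamma2)) * mono (- beta2) (- 0).
have Phi2K : Phi2 * Phi2V = 1.
  have -> : Phi2 * Phi2V =
    (mono 0 (- 2) * mono (- 0) (- - 2)) * (of_fps (fps_exp gamma2) * of_fps (fps_exp (- gamma2))) *
    (mono beta2 0 * mono (- beta2) (- 0)) by rewrite /Phi2V /Defs.Phi2 !oppr0; ring.
  by rewrite of_fps_expV !formal_monoV !mulr1.
(* The corner of the triangular inverse is [- Phi1^-1 (Phi1 J) Phi2^-1]. *)
exists (mx2 Phi1V (- (J * Phi2V)) 0 Phi2V).
rewrite mx2M !(mulr0, mul0r, addr0, add0r) -mx2_1 Phi2K mulrC Phi1K.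
by congr (mx2 _ _ _ _); ring.
Qed.

End FundamentalMatrix.

(** * Taylor estimates for powers and differentiability of power series *)

Section TaylorEstimates.
Variable K : numFieldType.
Implicit Types z h : K.

(** The difference, the derivative and the Taylor remainder are all bounded through the same
    [(|z| + 2)^k], so domination at this single radius controls all three series. The induction uses
    [|z + h| <= |z| + 1]. *)
Lemma expr_diff_le z h k : `|h| <= 1 ->
  `|(z + h) ^+ k - z ^+ k| <= `|h| * (`|z| + 2) ^+ k.
Proof.
move=> h1; elim: k => [|k IH].
  by rewrite !expr0 subrr normr0 mulr1.
have -> : (z + h) ^+ k.+1 - z ^+ k.+1 = (z + h) * ((z + h) ^+ k - z ^+ k) + h * z ^+ k.
  by rewrite !exprS; ring.
apply: le_trans (ler_normD _ _) _; rewrite !normrM normrX.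
have -> : `|h| * (`|z| + 2) ^+ k.+1 =
   (`|z| + 1) * (`|h| * (`|z| + 2) ^+ k) + `|h| * (`|z| + 2) ^+ k by rewrite exprS; ring.
apply: lerD.
  by apply: ler_pM => //; apply: le_trans (ler_normD _ _) _; rewrite lerD2l.
by apply: ler_wpM2l => //; apply: lerXn2r; rewrite ?nnegrE ?addr_ge0 // lerDl.
Qed.

(** The product rule for [z * z^k]; at [k = 0] the truncated exponent [k.-1] is harmless, since the
    multiple [*+ 0] vanishes. *)
Lemma expr_derivS z k : z ^+ k *+ k.+1 = z ^+ k + z * (z ^+ k.-1 *+ k).
Proof.
by rewrite mulrS; case: k => [|k]; rewrite ?mulr0n ?mulr0 //= exprS mulrnAr.
Qed.

(** The remainders satisfy [R_(k+1) = z R_k + h ((z + h)^k - z^k)], and [expr_diff_le] bounds the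
    second term. *)
Lemma expr_taylor_le z h k : `|h| <= 1 ->
  `|(z + h) ^+ k - z ^+ k - h * (z ^+ k.-1 *+ k)| <= `|h| ^+ 2 * (`|z| + 2) ^+ k.
Proof.
move=> h1; elim: k => [|k IH].
  by rewrite !expr0 mulr0n mulr0 subrr subr0 normr0 mulr1 exprn_ge0.
have -> : (z + h) ^+ k.+1 - z ^+ k.+1 - h * (z ^+ k *+ k.+1) =
   z * ((z + h) ^+ k - z ^+ k - h * (z ^+ k.-1 *+ k)) + h * ((z + h) ^+ k - z ^+ k).
  by rewrite expr_derivS !exprS; move: (z ^+ k.-1 *+ k) => t; ring.
apply: le_trans (ler_normD _ _) _; rewrite !normrM.
have -> : `|h| ^+ 2 * (`|z| + 2) ^+ k.+1 =
   (`|z| + 1) * (`|h| ^+ 2 * (`|z| + 2) ^+ k) + `|h| * (`|h| * (`|z| + 2) ^+ k)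
  by rewrite [(_ + 2) ^+ _]exprS; ring.
apply: lerD.
  by apply: ler_pM; rewrite ?lerDl.
by apply: ler_wpM2l => //; exact: expr_diff_le.
Qed.

Lemma cvg_series_lincomb (a b d : nat -> K) (c la lb ld : K) :
  series a @ \oo --> la -> series b @ \oo --> lb -> series d @ \oo --> ld ->
  series (fun k => a k - b k - c * d k) @ \oo --> la - lb - c * ld.
Proof.
move=> al bl dl.
have -> : series (fun k => a k - b k - c * d k) =
    (fun n => series a n - series b n - c * series d n).
  by apply/funext => n; rewrite /series /= mulr_sumr -!sumrB.
by apply: cvgB; [exact: cvgB|exact: cvgMr].
Qed.

Lemma expr_deriv_le z k : `|z ^+ k.-1 *+ k| <= (`|z| + 2) ^+ k.
Proof.
elim: k => [|k IH]; first by rewrite mulr0n normr0 expr0 ler01.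
rewrite [X in `|X|]expr_derivS.
apply: le_trans (ler_normD _ _) _; rewrite normrM normrX.
have r0 : 0 <= (`|z| + 2) ^+ k by rewrite exprn_ge0 // addr_ge0.
apply: (@le_trans _ _ ((`|z| + 2) ^+ k + `|z| * (`|z| + 2) ^+ k)).
  apply: lerD; last exact: ler_wpM2l.
  by apply: lerXn2r; rewrite ?nnegrE ?addr_ge0 // lerDl.
rewrite exprS -{1}[X in X + _]mul1r -mulrDl ler_wpM2r // addrC lerD2l.
by rewrite ler1n.
Qed.

(** The difference quotient is within [|h| M] of [G]. *)
Lemma derivable_quadratic (F : K -> K) (z G M : K) : 0 <= M ->
  (forall h, h != 0 -> `|h| <= 1 -> `|F (z + h) - F z - h * G| <= `|h| ^+ 2 * M) ->
  derivable F z 1.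
Proof.
move=> M0 quad; apply/cvg_ex; exists G; apply/cvgrPdist_le => e e0.
(* [M] may be [0], so [h] is made small by dividing by [M + 1]. *)
have M1 : 0 < M + 1 by rewrite ltr_wpDl.
near=> h.
have h0 : h != 0 by near: h; exact: nbhs_dnbhs_neq.
have h1 : `|h| <= 1.
  by apply: ltW; near: h; exact: dnbhs0_lt.
have he : `|h| * (M + 1) <= e.
  rewrite -ler_pdivlMr //; apply: ltW; near: h; apply: dnbhs0_lt.
  exact: divr_gt0.
rewrite /= -[h *: 1]/(h * 1) mulr1 -[_ *: _]/(h^-1 * _) (addrC h).
have -> : G - h^-1 * (F (z + h) - F z) = - (h^-1 * (F (z + h) - F z - h * G)) by field.
rewrite normrN normrM normfV.
apply: le_trans (_ : `|h| * M <= e); last first.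
  by apply: le_trans he; rewrite ler_wpM2l // lerDl.
rewrite ler_pdivrMl ?normr_gt0 // mulrA -expr2; exact: quad.
Unshelve. all: by end_near. Qed.

(* The hypothesis combines the convergence of [\sum |f k| r^k] with the completeness of [K]. *)
Lemma fps_entire_dominated (f : fps K) :
  (forall r : K, 0 <= r -> exists M, forall u : nat -> K,
     (forall k, `|u k| <= `|f k| * r ^+ k) ->
     exists2 l, series u @ \oo --> l & `|l| <= M) ->
  fps_entire f.
Proof.
move=> fr.
have Fcv z : series (fps_terms f z) @ \oo --> limn (series (fps_terms f z)).
  have [M /(_ (fps_terms f z))[|l lz _]] := fr _ (normr_ge0 z).
    by move=> n; rewrite normrM normrX.
  by apply/cvg_ex; exists l.
exists (fun z => limn (series (fps_terms f z))); split=> z; last exact: Fcv.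
have r0 : 0 <= `|z| + 2 by rewrite addr_ge0.
have [M fM] := fr _ r0.
pose d k := f k * (z ^+ k.-1 *+ k).
have [G dG GM] : exists2 G : K, series d @ \oo --> G & `|G| <= M.
  apply: fM => k; rewrite normrM; apply: ler_wpM2l => //; exact: expr_deriv_le.
apply: (@derivable_quadratic _ _ G M); first exact: le_trans GM.
move=> h h0 h1.
(* Termwise second-order remainders over [h^2]. They are dominated at radius [|z| + 2], hence their
   sum is bounded by the [M] fixed before [h]. *)
pose u k := h ^- 2 * (fps_terms f (z + h) k - fps_terms f z k - h * d k).
have [|l ul lM] := fM u.
  move=> k; have -> : u k = f k * (h ^- 2 * ((z + h) ^+ k - z ^+ k - h * (z ^+ k.-1 *+ k))).
    by rewrite /u /fps_terms /d; move: (z ^+ k.-1 *+ k) => t; ring.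
  rewrite normrM; apply: ler_wpM2l => //.
  rewrite normrM normfV normrX ler_pdivrMl ?exprn_gt0 ?normr_gt0 //.
  exact: expr_taylor_le.
have <- : h ^+ 2 * l = limn (series (fps_terms f (z + h))) - limn (series (fps_terms f z)) - h * G.
  have cl : series (fun k => h ^+ 2 * u k) @ \oo --> h ^+ 2 * l.
    have -> : series (fun k => h ^+ 2 * u k) = (fun n => h ^+ 2 * series u n).
      by apply/funext => n; rewrite /series /= mulr_sumr.
    exact: cvgMr.
  have uE : (fun k => h ^+ 2 * u k) = (fun k => fps_terms f (z + h) k - fps_terms f z k - h * d k).
    by apply/funext => k; rewrite /u mulrA divff ?mul1r // expf_neq0.
  rewrite uE in cl.
  by apply: (cvg_unique _ cl (cvg_series_lincomb (c := h) (Fcv (z + h)) (Fcv z) dG)).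
by rewrite normrM normrX ler_wpM2l // exprn_ge0.
Qed.

End TaylorEstimates.

(** * Dominated series of complex numbers *)

Section ComplexSeries.
Variable R : realType.
Local Notation C := (R[i] : numFieldType).
Implicit Types (z h : C) (u : nat -> C) (v : nat -> R).

Lemma normr_normc z : `|z| = (Normc.normc z)%:C.
Proof. by case: z. Qed.

Lemma normc_ge0 z : 0 <= Normc.normc z.
Proof. by case: z => a b; exact: sqrtr_ge0. Qed.

Lemma normcX z n : Normc.normc (z ^+ n) = Normc.normc z ^+ n.
Proof.
elim: n => [|n IH]; first by rewrite !expr0 Normc.normc1.
by rewrite !exprS Normc.normcM IH.
Qed.

Lemma normc_nat n : Normc.normc (n%:R : R[i]) = n%:R.
Proof. by apply: complexI; rewrite -normr_normc normr_nat rmorph_nat. Qed.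

(** The norm of [R[i]] has values in [R[i]], where a positive [e] is necessarily real; this passes
    to the real-valued modulus. *)
Lemma cvg_normc (T : Type) (F : set_system T) (FF : Filter F) (f : T -> C) (l : C) :
  (fun x => Normc.normc (l - f x)) @ F --> (0 : R) -> f @ F --> l.
Proof.
move=> /cvgr0Pnorm_le H; apply/cvgrPdist_le => e e0.
have eR : e = (complex.Re e)%:C.
  by move: e0; rewrite ltcE => /andP[/eqP i0 _]; case: e i0 => a b /= ->.
have re0 : 0 < complex.Re e by move: e0; rewrite ltcE => /andP[].
near=> x; rewrite eR normr_normc lecR.
have : `|Normc.normc (l - f x)| <= complex.Re e by near: x; exact: H.
by rewrite ger0_norm // normc_ge0.
Unshelve. all: by end_near. Qed.

Lemma normc_series_le u v m n : (forall k, Normc.normc (u k) <= v k) ->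
  (m <= n)%N -> Normc.normc (series u n - series u m) <= series v n - series v m.
Proof.
move=> uv mn; rewrite !sub_series_geq //.
elim/big_ind2 : _ => [||i _]; [by rewrite Normc.normc0| |exact: uv].
move=> a b c d ab cd; apply: le_trans (le_normcD _ _) _; exact: lerD.
Qed.

Lemma normr_Re_le z : `|complex.Re z| <= Normc.normc z.
Proof.
by case: z => a b /=; rewrite -sqrtr_sqr ler_wsqrtr // lerDl sqr_ge0.
Qed.

Lemma normr_Im_le z : `|complex.Im z| <= Normc.normc z.
Proof.
by case: z => a b /=; rewrite -sqrtr_sqr ler_wsqrtr // lerDr sqr_ge0.
Qed.

Lemma normc_le_ReIm (a b : R) : Normc.normc (a +i* b) <= `|a| + `|b|.
Proof.
rewrite -[leRHS]ger0_norm ?addr_ge0 //= -sqrtr_sqr ler_wsqrtr //.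
by rewrite sqrrD !real_normK ?num_real // lerD2r lerDl mulrn_wge0 // mulr_ge0.
Qed.

(** Real and imaginary parts converge absolutely by comparison. The tail bound serves twice: at
    [m = 0] it bounds the whole sum, and for general [m] it gives the decay of the tails of [S]. *)
Lemma series_dominated u v : (forall n, Normc.normc (u n) <= v n) ->
  cvgn (series v) ->
  exists2 l, series u @ \oo --> l &
    forall m, Normc.normc (l - series u m) <= limn (series v) - series v m.
Proof.
move=> uv cv.
have part (p : C -> R) : (forall z, `|p z| <= Normc.normc z) ->
    cvgn (series (p \o u)).
  move=> pn; apply: normed_cvg; apply: series_le_cvg cv => n //=.
    exact: le_trans (normc_ge0 _) (uv n).
  exact: le_trans (pn _) (uv n).
have cR := part _ normr_Re_le; have cI := part _ normr_Im_le.
set a := limn (series (@complex.Re R \o u)) in cR.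
set b := limn (series (@complex.Im R \o u)) in cI.
have uE n : series u n = series (@complex.Re R \o u) n +i* series (@complex.Im R \o u) n.
  elim: n => [|n IH]; first by rewrite !seriesEnat /= !big_nil.
  by rewrite !seriesSr IH; case E : (u n) => [x y] /=; rewrite E.
have dist (w : nat -> R) : cvgn w -> (fun n => `|limn w - w n|) @ \oo --> (0 : R).
  move=> cw; have -> : (0 : R) = `|limn w - limn w| by rewrite subrr normr0.
  by apply: cvg_norm; apply: cvgB => //; exact: cvg_cst.
have dist0 : (fun n => Normc.normc ((a +i* b : C) - series u n)) @ \oo --> (0 : R).
  apply: (@squeeze_cvgr _ _ _ _ (cst 0) (fun n => `|a - series (@complex.Re R \o u) n| +
      `|b - series (@complex.Im R \o u) n|)).
  - apply: nearW => n; rewrite normc_ge0 /= uE; exact: normc_le_ReIm.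
  - exact: cvg_cst.
  - rewrite -[X in _ --> X]addr0; apply: cvgD; exact: dist.
exists (a +i* b); first exact: cvg_normc.
(* Up to [e], the limit is replaced by a partial sum of some index [n >= m]. *)
move=> m; apply/ler_addgt0Pr => e e0.
have [n [mn ne]] : exists n, (m <= n)%N /\ Normc.normc ((a +i* b : C) - series u n) <= e.
  near \oo => n; exists n; split; first by near: n; exact: nbhs_infty_ge.
  rewrite -[leLHS]ger0_norm ?normc_ge0 //; near: n.
  by move/cvgr0Pnorm_le: dist0; apply.
have -> : (a +i* b : C) - series u m =
    ((a +i* b : C) - series u n) + (series u n - series u m) by rewrite addrA subrK.
apply: le_trans (le_normcD _ _) _; rewrite addrC; apply: lerD => //.
apply: le_trans (normc_series_le uv mn) _; rewrite lerD2r.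
apply: nondecreasing_cvgn_le => //; apply: nondecreasing_series => k _.
by rewrite (le_trans (normc_ge0 _) (uv k)).
Unshelve. all: by end_near. Qed.

Lemma series_limit_unique u l : series u @ \oo --> l -> limn (series u) = l.
Proof. by apply: cvg_lim; exact: norm_hausdorff. Qed.

Lemma series_cstM (c : R) v : cvgn (series v) ->
  cvgn (series (fun k => c * v k)) /\ limn (series (fun k => c * v k)) = c * limn (series v).
Proof.
move=> cv; rewrite -[fun k => c * v k]/(c *: v).
by split; [exact: is_cvg_seriesZ|rewrite lim_seriesZ].
Qed.

(** The uniform bound required by [fps_entire_dominated] is the sum of the series of moduli at
    [r]. *)
Lemma fps_entire_normc (f : fps C) :
  (forall r : R, 0 <= r -> cvgn (series (fun k => Normc.normc (f k) * r ^+ k))) ->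
  fps_entire f.
Proof.
move=> fr; apply: fps_entire_dominated => r r0.
have rE : r = (complex.Re r)%:C.
  by move: r0; rewrite lecE => /andP[/eqP i0 _]; case: r i0 => a b /= ->.
have {}r0 : 0 <= complex.Re r by move: r0; rewrite lecE => /andP[].
pose v k := Normc.normc (f k) * complex.Re r ^+ k.
exists (limn (series v))%:C => u uv.
have [|l ul lv] := @series_dominated u v _ (fr _ r0).
  by move=> k; rewrite -lecR rmorphM rmorphXn /= -rE -!normr_normc.
exists l => //; rewrite normr_normc lecR.
by have := lv 0%N; rewrite /series /= !big_geq // !subr0.
Qed.

End ComplexSeries.

(** * Convergence of [S], and divergence or analyticity of [psi_hat] *)

Section PartialSums.
Variables (R : realType) (beta gamma : R[i]).
Local Notation C := (R[i] : numFieldType).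
Local Notation psi := (psi_hat (beta : C) gamma).
Local Notation S_term := (S_term (beta : C) gamma).

Let c : R := Normc.normc gamma * Normc.normc beta.
Let v n : R := c ^+ n / (n`!%:R * n.+1`!%:R).

Let fact_gt0R n : 0 < n`!%:R :> R. Proof. by rewrite ltr0n fact_gt0. Qed.

Let c0 : 0 <= c. Proof. by rewrite mulr_ge0 ?normc_ge0. Qed.

Let v0 n : 0 <= v n.
Proof. by rewrite divr_ge0 ?mulr_ge0 ?exprn_ge0 ?c0 ?ler0n. Qed.

Let normc_sign n : Normc.normc ((- 1) ^+ n : R[i]) = 1.
Proof.
rewrite normcX (_ : Normc.normc _ = 1) ?expr1n //.
by rewrite /= oppr0 sqrrN expr1n expr0n addr0 sqrtr1.
Qed.

Lemma normc_S_term n : Normc.normc (S_term n) = v n.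
Proof.
rewrite /Defs.S_term !Normc.normcM Normc.normcV Normc.normcM !normc_nat !normcX.
by rewrite -normcX normc_sign mul1r -exprMn.
Qed.

(** Here [i! >= k! (i - k)!], the quotient being a binomial coefficient, and [(i + 1)! >= k!]. Of
    the resulting [k!^2], one factor will cancel the [k!] in [psi_k] and the other makes [psi]
    entire. *)
Let v_tail_le k i : (k <= i)%N -> v i <= c ^+ k / k`!%:R ^+ 2 * exp_coeff c (i - k)%N.
Proof.
move=> ki; rewrite /v /exp_coeff /= mulf_div -exprD subnKC //.
have den : 0 < k`!%:R ^+ 2 * (i - k)`!%:R :> R by rewrite mulr_gt0 ?exprn_gt0 ?fact_gt0R.
apply: ler_wpM2l; first exact/exprn_ge0/c0.
rewrite lef_pV2 ?posrE ?mulr_gt0 ?fact_gt0R // expr2 -!natrM ler_nat -mulnA mulnC.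
apply: leq_mul; last exact/leq_fact/leqW.
by rewrite -(bin_fact ki) leq_pmull // bin_gt0.
Qed.

Let v_cvg : cvgn (series v).
Proof.
apply: series_le_cvg (is_cvg_series_exp_coeff c) => // n.
  exact/exp_coeff_ge0/c0.
have := @v_tail_le 0 n (leq0n n).
by rewrite expr0 fact0 expr1n divr1 mul1r subn0.
Qed.

Let v_tail k : limn (series v) - series v k <= c ^+ k / k`!%:R ^+ 2 * expR c.
Proof.
rewrite lerBlDl; apply: limr_le => //; near=> n.
have kn : (k <= n)%N by near: n; exact: nbhs_infty_ge.
rewrite -lerBlDl sub_series_geq //.
apply: (@le_trans _ _ (\sum_(k <= i < n) c ^+ k / k`!%:R ^+ 2 * exp_coeff c (i - k)%N)).
  by apply: ler_sum_nat => i /andP[ki _]; exact: v_tail_le.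
rewrite -mulr_sumr; apply: ler_wpM2l; first by rewrite divr_ge0 ?exprn_ge0 ?c0 ?ler0n.
rewrite -{1}[k]add0n big_addn; under eq_bigr do rewrite addnK.
apply: nondecreasing_cvgn_le; last exact: is_cvg_series_exp_coeff.
by apply: nondecreasing_series => i _ _; exact/exp_coeff_ge0/c0.
Unshelve. all: by end_near. Qed.

Lemma S_absolutely_convergent : absolutely_convergent S_term.
Proof.
have [|l ul _] := @series_dominated R (fun n => `|S_term n|) v _ v_cvg.
  by move=> n; rewrite -lecR -normr_normc normr_id normr_normc normc_S_term.
by apply/cvg_ex; exists l.
Qed.

Lemma S_convergent : series_converges_to S_term (S_sum (beta : C) gamma).
Proof.
have [|l ul _] := @series_dominated R S_term v _ v_cvg.
  by move=> n; rewrite normc_S_term.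
by apply/cvg_ex; exists l.
Qed.

Lemma psi_hat_coef k : psi k = (- 1) ^+ k * k`!%:R * series S_term k / beta ^+ k.
Proof. by case: k => [|k] //; rewrite /= /series /= big_geq // mulr0 mul0r. Qed.

Hypothesis beta_neq0 : beta != 0.

Lemma psi_hat_divergent : S_sum (beta : C) gamma <> 0 -> fps_divergent psi.
Proof.
move=> S0 z z0 /cvg_series_cvg_0 psi0; apply: S0.
pose t k : C := (- (beta / z)) ^+ k / k`!%:R.
have t0 : t @ \oo --> (0 : C).
  apply: cvg_series_cvg_0.
  have cvE := is_cvg_series_exp_coeff (Normc.normc (- (beta / z))).
  have [|l tl _] := @series_dominated R t _ _ cvE.
    by move=> n; rewrite Normc.normcM normcX Normc.normcV normc_nat.
  by apply/cvg_ex; exists l.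
have : (fps_terms psi z \* t) @ \oo --> (0 * 0 : C) by exact: cvgM.
rewrite mulr0.
(* Signs, factorials and powers of [beta] and [z] all cancel. *)
have -> : fps_terms psi z \* t = series S_term.
  apply/funext => k /=; rewrite /fps_terms psi_hat_coef /t.
  have k0 : k`!%:R != 0 :> C by rewrite pnatr_eq0 -lt0n fact_gt0.
  have aux (K : fieldType) (u s b w : K) : u != 0 -> b != 0 -> w != 0 ->
      (- 1) ^+ k * u * s / b ^+ k * w ^+ k * ((- (b / w)) ^+ k / u) = s.
    move=> u0 b0 w0; rewrite [(- (b / w)) ^+ k]exprNn expr_div_n.
    transitivity ((- 1) ^+ k * (- 1) ^+ k * s); last by rewrite -expr2 sqrr_sign mul1r.
    move: (expf_neq0 k b0) (expf_neq0 k w0).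
    move: ((- 1) ^+ k) (b ^+ k) (w ^+ k) => e p q p0 q0.
    by field; rewrite u0 p0 q0.
  exact: aux.
exact: series_limit_unique.
Qed.

Lemma psi_hat_entire : S_sum (beta : C) gamma = 0 -> fps_entire psi.
Proof.
move=> S0; apply: fps_entire_normc => r r0.
have [|l ul lv] := @series_dominated R S_term v _ v_cvg.
  by move=> n; rewrite normc_S_term.
have l0 : l = 0 by rewrite -(series_limit_unique ul).
have nb : 0 < Normc.normc beta.
  rewrite lt_neqAle normc_ge0 andbT eq_sym.
  by apply: contra_neq beta_neq0; exact: Normc.eq0_normc.
have psi_le k : Normc.normc (psi k) <= Normc.normc gamma ^+ k / k`!%:R * expR c.
  rewrite psi_hat_coef !Normc.normcM Normc.normcV normc_sign mul1r normc_nat normcX.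
  rewrite ler_pdivrMr ?exprn_gt0 // -ler_pdivlMl //.
  (* As the sum is [0], the tail bound is a bound on the partial sum itself. *)
  have := le_trans (lv k) (v_tail k); rewrite l0 sub0r.
  have -> : Normc.normc (- series S_term k) = Normc.normc (series S_term k).
    by apply: complexI; rewrite -!normr_normc normrN.
  move/le_trans; apply; rewrite /c exprMn.
  rewrite le_eqVlt; apply/orP; left; apply/eqP; field.
  by rewrite lt0r_neq0.
(* The majorant of [|psi_k| r^k] is [exp c] times the exponential series at [|gamma| r]. *)
have cvE : cvgn (series (fun k => expR c * exp_coeff (Normc.normc gamma * r) k)).
  exact: (series_cstM _ (is_cvg_series_exp_coeff _)).1.
apply: series_le_cvg cvE => k.
- by rewrite mulr_ge0 ?normc_ge0 ?exprn_ge0.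
- by rewrite mulr_ge0 ?expR_ge0 ?exp_coeff_ge0 // mulr_ge0 // normc_ge0.
rewrite /exp_coeff /= exprMn.
apply: le_trans (ler_wpM2r (exprn_ge0 k r0) (psi_le k)) _.
by rewrite le_eqVlt; apply/orP; left; apply/eqP; ring.
Qed.

End PartialSums.

Theorem proposition3p2 (R : realType) (beta1 beta2 gamma1 gamma2 : R[i]) :
  beta1 <> beta2 ->
  let beta := beta2 - beta1 in
  let gamma := gamma2 - gamma1 in
  let psi := psi_hat beta gamma in
  let S := S_sum beta gamma in
  (exists Phi0 : 'M[formal R[i]]_2,
     unique (fun Phi =>
       formal_fundamental_matrix beta1 beta2 gamma1 gamma2 Phi /\
       exists H, Phi = normal_form beta1 beta2 gamma1 gamma2 H) Phi0 /\
     forall H : 'M[fps R[i]]_2,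
       Phi0 = normal_form beta1 beta2 gamma1 gamma2 H <->
       H = H_hat beta gamma psi) /\
  (absolutely_convergent (S_term beta gamma) /\
   series_converges_to (S_term beta gamma) S) /\
  (S <> 0 -> gamma1 <> gamma2 -> fps_divergent psi) /\
  (S = 0 -> gamma1 <> gamma2 -> fps_entire psi) /\
  (gamma1 = gamma2 ->
     (exists r : fps R[i],
        psi = fps_const beta^-1 * fps_X _ + fps_X _ ^+ 2 * r) /\
     H_hat beta gamma psi = H_hat beta gamma (fps_const beta^-1 * fps_X _) /\
     H_hat beta gamma psi = mx2 1 (fps_const beta^-1 * fps_X _ ^+ 2) 0 1).
Proof.
move=> /eqP beta12 beta gamma psi S.
have beta0 : beta != 0 by rewrite subr_eq0 eq_sym.
split.
  exists (normal_form beta1 beta2 gamma1 gamma2 (H_hat beta gamma psi)); split.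
    split=> [|Phi [[_ tri] [H PhiE]]].
      have tri := (triangular_normal_form gamma1 gamma2 beta0 (H_hat beta gamma psi)).2 erefl.
      split; last by exists (H_hat beta gamma psi).
      by split=> //; exact: triangular_fundamental.
    by move: tri; rewrite PhiE => /(triangular_normal_form gamma1 gamma2 beta0) ->.
  by move=> H; split=> [/normal_form_inj|->].
split; first by split; [exact: S_absolutely_convergent|exact: S_convergent].
split; first by move=> S0 _; exact: psi_hat_divergent.
split; first by move=> S0 _; exact: psi_hat_entire.
move=> gamma12.
have gamma0 : gamma = 0 by rewrite /gamma gamma12 subrr.
(* The factor [gamma / beta] of [p] vanishes, so [H_hat] is the same for every [p]. *)
have H0 p : H_hat beta gamma p = mx2 1 (fps_const beta^-1 * fps_X _ ^+ 2) 0 1.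
  rewrite /H_hat gamma0 mul0r fps_exp0 mulr1.
  by rewrite (fps_const_nat _ 0) !mul0r subr0.
split; last by rewrite !H0.
(* The witness is [psi] without its first two coefficients, divided by [x^2]. The coefficient at
   index [1] is [1 / beta] because the first term of [S] is [- 1]. *)
exists (Fps (fun k => psi k.+2)); apply: fpsP => k.
rewrite fps_coefD fps_coef_constM expr2 -mulrA fps_coefXM.
case: k => [|[|k]].
- by rewrite /= mulr0 addr0.
- rewrite fps_coefXM /= mulr1 addr0 /series /= big_nat1 /S_term.
  by rewrite !expr0 !expr1 !mulr1 divr1 mulrNN mul1r mul1r.
- by rewrite fps_coefXM /= mulr0 add0r.
Qed.
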